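(* Let $h:\mathbb{R}^n\to\mathbb{R}$ be twice continuously differentiable with bounded Hessian, and let $P:\mathbb{R}^n\to(-\infty,\infty]$ be a proper closed function such that for every $u\in\mathbb{R}^n$ and $\tau>0$ the function $y\mapsto\tau P(y)+\frac12\|y-u\|^2$ has a minimizer. Suppose that there exist a twice continuously differentiable convex function $q:\mathbb{R}^n\to\mathbb{R}$ and $\ell>0$ such that for all $x\in\mathbb{R}^n$, $$-\ell\,\mathcal{I}\preceq\nabla^2h(x)+\nabla^2q(x)\preceq\ell\,\mathcal{I}.$$ Let $\beta\in(0,\frac1\ell)$ and let $\{x^t\}_{t\ge0}$ be generated from the proximal gradient algorithm $$x^{t+1}\in\operatorname{Arg\,min}_x\left\{\langle\nabla h(x^t),x-x^t\rangle+\frac{1}{2\beta}\|x-x^t\|^2+P(x)\right\}.$$ Then the algorithm is a descent algorithm, i.e. $h(x^{t+1})+P(x^{t+1})\le h(x^t)+P(x^t)$ for all $t\ge0$. Moreover, any cluster point $x^*$ of $\{x^t\}$, if one exists, is a stationary point of the problem $\min_x h(x)+P(x)$.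
   Context: Proper means finite somewhere and never $-\infty$; closed means lower semicontinuous; $P$ and $h$ need not be convex. $\operatorname{Arg\,min}$ denotes the set of (global) minimizers. $\mathcal{I}$ is the identity map, and $\mathcal{A}\preceq\mathcal{B}$ means $\mathcal{B}-\mathcal{A}$ is positive semidefinite. For a proper $f$ and $x\in\mathrm{dom}\,f=\{x: f(x)<\infty\}$, $\partial f(x)$ is the limiting subdifferential: the set of $v$ for which there exist $x^t\to x$ with $f(x^t)\to f(x)$ and $v^t\to v$ such that $\liminf_{z\to x^t,\, z\ne x^t}\frac{f(z)-f(x^t)-\langle v^t,z-x^t\rangle}{\|z-x^t\|}\ge0$ for each $t$; $\partial f(x)=\emptyset$ for $x\notin\mathrm{dom}\,f$. A point $\tilde x$ is a stationary point of $\min_x h(x)+P(x)$ if $0\in\partial(h+P)(\tilde x)=\nabla h(\tilde x)+\partial P(\tilde x)$. *)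

(* Defs.v *)
From HB Require Import structures.
From mathcomp Require Import all_boot all_order all_algebra.
From mathcomp Require Import all_classical all_reals all_analysis.
Set Implicit Arguments.
Unset Strict Implicit.
Unset Printing Implicit Defensive.
Import Order.TTheory GRing.Theory Num.Theory.
Import numFieldNormedType.Exports.
Local Open Scope classical_set_scope.
Local Open Scope ring_scope.

(* R^n is 'rV[R]_n. The library norm `|x| on it is the max norm; it induces the
   usual topology and the usual notions of differentiability and boundedness,
   but wherever the value of the norm matters [enorm] is used instead. *)
Definition dot (R : realType) (n : nat) (u v : 'rV[R]_n) : R := (u *m v^T) 0 0.

Definition enorm (R : realType) (n : nat) (u : 'rV[R]_n) : R :=
  Num.sqrt (dot u u).

Definition gradient (R : realType) (n : nat) (f : 'rV[R]_n -> R)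
    (x : 'rV[R]_n) : 'rV[R]_n :=
  \row_i 'd f x (delta_mx 0 i).

Definition hessian (R : realType) (n : nat) (f : 'rV[R]_n -> R)
    (x : 'rV[R]_n) : 'M[R]_n :=
  'J (gradient f) x.

Definition twice_continuously_differentiable (R : realType) (n : nat)
    (f : 'rV[R]_n -> R) : Prop :=
  [/\ forall x, differentiable f x,
      forall x, differentiable (gradient f) x
    & continuous (hessian f)].

(* Symmetry is not demanded: the matrices compared below are Hessians of twice
   continuously differentiable functions, hence symmetric. *)
Definition positive_semidefinite (R : realType) (n : nat) (A : 'M[R]_n) : Prop :=
  forall v : 'rV[R]_n, 0 <= dot (v *m A) v.

Definition loewner_le (R : realType) (n : nat) (A B : 'M[R]_n) : Prop :=
  positive_semidefinite (B - A).

Definition effective_domain (T : Type) (R : realType) (f : T -> \bar R) : set T :=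
  [set x | (f x < +oo)%E].

Definition proper_function (T : Type) (R : realType) (f : T -> \bar R) : Prop :=
  effective_domain f !=set0 /\ forall x, (-oo < f x)%E.

Definition argmin (T : Type) (R : realType) (f : T -> \bar R) : set T :=
  [set x | forall y, (f x <= f y)%E].

(* x^' is the filter of punctured neighbourhoods of x. *)
Definition regular_subdifferential (R : realType) (n : nat)
    (f : 'rV[R]_n -> \bar R) (x : 'rV[R]_n) : set 'rV[R]_n :=
  [set v | x \in effective_domain f /\
    (0 <= limf_einf
            (fun z => (f z - f x - (dot v (z - x))%:E)
                        * ((enorm (z - x))^-1)%:E) x^')%E].

Definition limiting_subdifferential (R : realType) (n : nat)
    (f : 'rV[R]_n -> \bar R) (x : 'rV[R]_n) : set 'rV[R]_n :=
  [set v | x \in effective_domain f /\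
    exists (xs vs : nat -> 'rV[R]_n),
      [/\ xs t @[t --> \oo] --> x,
          f (xs t) @[t --> \oo] --> f x,
          vs t @[t --> \oo] --> v
        & forall t, regular_subdifferential f (xs t) (vs t)]].

Definition objective (R : realType) (n : nat) (h : 'rV[R]_n -> R)
    (P : 'rV[R]_n -> \bar R) (x : 'rV[R]_n) : \bar R :=
  ((h x)%:E + P x)%E.

Definition stationary_point (R : realType) (n : nat) (h : 'rV[R]_n -> R)
    (P : 'rV[R]_n -> \bar R) (x : 'rV[R]_n) : Prop :=
  limiting_subdifferential (objective h P) x 0.

Definition prox_objective (R : realType) (n : nat) (P : 'rV[R]_n -> \bar R)
    (tau : R) (u y : 'rV[R]_n) : \bar R :=
  (tau%:E * P y + (2^-1 * enorm (y - u) ^+ 2)%:E)%E.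

Definition prox_gradient_model (R : realType) (n : nat) (h : 'rV[R]_n -> R)
    (P : 'rV[R]_n -> \bar R) (beta : R) (xt x : 'rV[R]_n) : \bar R :=
  ((dot (gradient h xt) (x - xt)
      + (2 * beta)^-1 * enorm (x - xt) ^+ 2)%:E + P x)%E.

(* x 0 is arbitrary, possibly outside the effective domain of P. *)
Definition prox_gradient_sequence (R : realType) (n : nat) (h : 'rV[R]_n -> R)
    (P : 'rV[R]_n -> \bar R) (beta : R) (x : nat -> 'rV[R]_n) : Prop :=
  forall t, argmin (prox_gradient_model h P beta (x t)) (x t.+1).

(* Main.v *)
Require Import Defs.
From HB Require Import structures.
From mathcomp Require Import all_boot all_order all_algebra.
From mathcomp Require Import all_classical all_reals all_analysis.
From mathcomp Require Import ring lra.
Set Implicit Arguments.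
Unset Strict Implicit.
Unset Printing Implicit Defensive.
Import Order.TTheory GRing.Theory Num.Theory.
Import numFieldNormedType.Exports.
Local Open Scope classical_set_scope.
Local Open Scope ring_scope.

(** The Hessian bound on [h + q] gives a quadratic upper bound with constant [l]
for [h + q]; subtracting the gradient inequality of the convex [q] leaves the
same bound for [h] alone,
  h y <= h x + <grad h x, y - x> + l / 2 |y - x|^2
([descent_of_convex_shift]). So the curvature of [h] from above is controlled
by [l] although its curvature from below is not. Adding this to the inequality
saying that the model at [x t] is not larger at its minimizer [x t.+1] than at
[x t] gives
  F (x t.+1) + (beta^-1 - l) / 2 |x t.+1 - x t|^2 <= F (x t),  F = h + P
([prox_step_sufficient_decrease]), which is a descent because [beta^-1 > l].

Let [a] be a cluster point. Lower semicontinuity of [P] at [a] bounds [F]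
below infinitely often, hence always, along the nonincreasing values of [F], and
rules out [P a = +oo]. The decreases are then summable, so the steps tend to 0
([decrease_cvg0]), and if [x (s k)] tends to [a] then so does [x (s k).+1].
Comparing the model minimizer with [a] itself gives [P (x (s k).+1) --> P a]
([prox_value_cvg]). Finally minimality of [p = x t.+1] for the model at
[u = x t] shows directly, without a sum rule, that
  grad h p - grad h u - beta^-1 (p - u)
is a regular subgradient of [F] at [p] ([prox_step_regular_subgradient]). Along
the subsequence these vectors tend to 0 by continuity of [grad h], which is
stationarity of [a]. *)

(** * Euclidean inner product and norm *)

Section dot_algebra.
Variables (R : realType) (n : nat).
Implicit Types (u v w d : 'rV[R]_n) (a : R).

Lemma dotE u v : dot u v = \sum_i u 0 i * v 0 i.
Proof. by rewrite /dot mxE; apply: eq_bigr => i _; rewrite mxE. Qed.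

Lemma dotC u v : dot u v = dot v u.
Proof. by rewrite !dotE; apply: eq_bigr => i _; rewrite mulrC. Qed.

Lemma dotDl u v w : dot (u + v) w = dot u w + dot v w.
Proof. by rewrite /dot mulmxDl mxE. Qed.

Lemma dotZl a u v : dot (a *: u) v = a * dot u v.
Proof. by rewrite /dot -scalemxAl mxE. Qed.

Lemma dotNl u v : dot (- u) v = - dot u v.
Proof. by rewrite -scaleN1r dotZl mulN1r. Qed.

Lemma dotDr u v w : dot u (v + w) = dot u v + dot u w.
Proof. by rewrite !(dotC u) dotDl. Qed.

Lemma dotZr a u v : dot u (a *: v) = a * dot u v.
Proof. by rewrite !(dotC u) dotZl. Qed.

Lemma dotNr u v : dot u (- v) = - dot u v.
Proof. by rewrite !(dotC u) dotNl. Qed.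

Lemma dot0l u : dot 0 u = 0.
Proof. by rewrite -(scale0r 0) dotZl mul0r. Qed.

Definition dot_lin := (dotDl, dotDr, dotNl, dotNr, dotZl, dotZr).

Lemma dot_ge0 u : 0 <= dot u u.
Proof. by rewrite dotE; apply: sumr_ge0 => i _; rewrite -expr2 sqr_ge0. Qed.

Lemma sqr_enorm u : enorm u ^+ 2 = dot u u.
Proof. by rewrite /enorm sqr_sqrtr// dot_ge0. Qed.

(** Links the two norms: [`| |] is the max norm, which governs the topology. *)
Lemma ler_norm_enorm u : `|u| <= enorm u.
Proof.
rewrite {1}/Num.norm/= mx_normrE; apply/bigmax_leP; split=> /=.
  exact: sqrtr_ge0.
move=> [i j] _ /=; rewrite (ord1 i) -sqrtr_sqr /enorm ler_wsqrtr//.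
rewrite dotE (bigD1 j)//= -expr2 lerDl.
by apply: sumr_ge0 => k _; rewrite -expr2 sqr_ge0.
Qed.

Lemma enorm_gt0 u : u != 0 -> 0 < enorm u.
Proof. by rewrite -normr_gt0 => /lt_le_trans; apply; exact: ler_norm_enorm. Qed.

Lemma cvg_dot (T : Type) (F : set_system T) (FF : Filter F)
    (f g : T -> 'rV[R]_n) u v :
  f x @[x --> F] --> u -> g x @[x --> F] --> v ->
  dot (f x) (g x) @[x --> F] --> dot u v.
Proof.
move=> fu gv; under eq_fun do rewrite dotE; rewrite dotE.
apply: (@cvg_big _ _ +%R) => //; first exact: add_continuous.
move=> i _; apply: cvgM.
  exact: cvg_comp fu (@coord_continuous _ _ _ 0 i u).
exact: cvg_comp gv (@coord_continuous _ _ _ 0 i v).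
Qed.

End dot_algebra.

Lemma enorm_cvg (R : realType) (n : nat) (x : 'rV[R]_n) :
  enorm (z - x) @[z --> x] --> (0 : R).
Proof.
have -> : (0 : R) = Num.sqrt (dot (x - x) (x - x)).
  by rewrite subrr dot0l sqrtr0.
have Fx : Filter (nbhs x) by have [] := nbhs_pfilter x.
have zx : z - x @[z --> x] --> x - x.
  by apply: (@cvgB _ _ _ _ _ id (cst x)); [exact: cvg_id|exact: cvg_cst].
have dz := cvg_dot Fx zx zx.
exact: cvg_comp dz (@sqrt_continuous _ _).
Qed.

(** * Second-order upper bound, convexity and first-order expansion *)

Section calculus.
Variables (R : realType) (n : nat).
Implicit Types (f q : 'rV[R]_n -> R) (x y d : 'rV[R]_n).

Lemma diff_dot f x d : differentiable f x -> 'd f x d = dot (gradient f x) d.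
Proof.
move=> dfx; rewrite {1}(row_sum_delta d) linear_sum dotE.
by apply: eq_bigr => i _; rewrite linearZ mxE mulrC.
Qed.

Lemma is_derive_line (W : normedModType R) (F : 'rV[R]_n -> W) x d s :
  differentiable F (x + s *: d) ->
  is_derive s (1 : R) (fun t : R => F (x + t *: d)) ('d F (x + s *: d) d).
Proof.
move=> dF.
have quotE : (fun h : R => h^-1 *: (((fun t : R => F (x + t *: d)) \o shift s)
      (h *: 1) - F (x + s *: d))) =
    (fun h : R => h^-1 *: ((F \o shift (x + s *: d)) (h *: d) - F (x + s *: d))).
  apply/funext => h /=; congr (_ *: (F _ - _)).
  by rewrite [h *: 1]mulr1 scalerDl addrCA.
apply: DeriveDef; rewrite /derivable /derive quotE; first exact: diff_derivable.
exact: deriveE.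
Qed.

Lemma is_derive_sub_quad (F : R -> R) (df a b s : R) :
  is_derive s (1 : R) F df ->
  is_derive s (1 : R) (fun t : R => F t - (t * a + t ^+ 2 * b))
    (df - (a + 2 * b * s)).
Proof.
move=> dF.
have lin : is_derive s (1 : R) (fun t : R => t * a + t ^+ 2 * b) (a + 2 * b * s).
  by apply: is_derive_eq; rewrite /GRing.scale/=; ring.
exact: is_deriveB.
Qed.

Lemma is_derive_dot (G : R -> 'rV[R]_n) s v d :
  is_derive s (1 : R) G v ->
  is_derive s (1 : R) (fun t => dot (G t) d) (dot v d).
Proof.
move=> [dG <-].
have quotE : (fun h : R => h^-1 *: (((fun t => dot (G t) d) \o shift s) (h *: 1)
      - dot (G s) d)) =
    (fun h : R => dot (h^-1 *: ((G \o shift s) (h *: 1) - G s)) d).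
  by apply/funext => h; rewrite !dot_lin.
have lim_quot : (fun h : R => h^-1 *: (((fun t => dot (G t) d) \o shift s) (h *: 1)
      - dot (G s) d)) @ 0^' --> dot ('D_1 G s) d.
  by rewrite quotE; apply: cvg_dot dG _; exact: cvg_cst.
apply: DeriveDef; first by apply/cvg_ex; exists (dot ('D_1 G s) d).
exact: cvg_lim.
Qed.

Lemma derive_le0_le (f f' : R -> R) (s : R) :
  (forall t, is_derive t (1 : R) f (f' t)) -> (forall t, 0 <= t -> f' t <= 0) ->
  0 <= s -> f s <= f 0.
Proof.
move=> fE f'0 s0.
have fC : {within `[0, s], continuous f}.
  apply: derivable_within_continuous => t _.
  exact: (@ex_derive _ _ _ _ _ _ _ (fE t)).
have [c] := MVT_segment s0 (fun t _ => fE t) fC.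
rewrite in_itv/= => /andP[c0 _] fs; rewrite -subr_le0 fs subr0.
by rewrite mulr_le0_ge0// f'0.
Qed.

(** Integrates an affine bound on the derivative; applied once to the slope and
once to the function itself, it replaces Taylor's formula. *)
Lemma derive_affine_le (f f' : R -> R) (a b s : R) :
  (forall t, is_derive t (1 : R) f (f' t)) ->
  (forall t, 0 <= t -> f' t <= a + 2 * b * t) ->
  0 <= s -> f s <= f 0 + s * a + s ^+ 2 * b.
Proof.
move=> fE f'le s0.
have := derive_le0_le (fun t => is_derive_sub_quad a b (fE t)) _ s0.
rewrite mul0r expr0n mul0r addr0 subr0 lerBlDr addrA; apply=> t t0.
by rewrite subr_le0 f'le.
Qed.

(** On the segment from [x] to [y], the bound on the derivative of [G] makes the
slope of [f] grow at most linearly, so [f] grows at most quadratically. The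
gradient enters as a function [G] so that a sum of gradients can be used for the
gradient of a sum. *)
Lemma quadratic_upper_bound f (G : 'rV[R]_n -> 'rV[R]_n) (l : R) x y :
  (forall z, differentiable f z) -> (forall z v, 'd f z v = dot (G z) v) ->
  (forall z, differentiable G z) ->
  (forall z v, dot ('d G z v) v <= l * dot v v) ->
  f y <= f x + dot (G x) (y - x) + l / 2 * dot (y - x) (y - x).
Proof.
move=> df dfE dG dG_le; set d := y - x.
have D1 s : is_derive s (1 : R) (fun t => f (x + t *: d))
    (dot (G (x + s *: d)) d).
  by rewrite -dfE; exact: is_derive_line.
have D2 s : is_derive s (1 : R) (fun t => dot (G (x + t *: d)) d)
    (dot ('d G (x + s *: d) d) d).
  by apply: is_derive_dot; exact: is_derive_line.
have slope_le s : 0 <= s ->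
    dot (G (x + s *: d)) d <= dot (G x) d + s * (l * dot d d).
  move=> s0; have := @derive_affine_le _ _ (l * dot d d) 0 s D2.
  rewrite [s ^+ 2 * 0]mulr0 addr0 [0 *: d]scale0r [x + 0]addr0; apply=> // t _.
  by rewrite [2 * 0]mulr0 [0 * t]mul0r [_ + 0]addr0 dG_le.
have := @derive_affine_le _ _ (dot (G x) d) (l / 2 * dot d d) 1 D1.
have -> : x + 1 *: d = y by rewrite scale1r addrC subrK.
rewrite expr1n !mul1r [0 *: d]scale0r [x + 0]addr0; apply=> // t t0.
by rewrite (le_trans (slope_le t t0))// lerD2l le_eqVlt; apply/orP; left;
  apply/eqP; field.
Qed.

(** By convexity, every difference quotient with step [t] in ]0, 1] in the
direction [y - x] is at most [q y - q x]; let [t] tend to 0. *)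
Lemma convex_gradient_le q x y : convex_function setT q -> differentiable q x ->
  q x + dot (gradient q x) (y - x) <= q y.
Proof.
move=> cq dq; rewrite -lerBrDl -diff_dot// -deriveE//.
have dr := cvg_dnbhs_at_right (@diff_derivable _ _ _ _ _ (y - x) dq).
apply: cvgr_to_le dr _.
near=> t => /=.
have t0 : 0 < t by [].
have t1 : t <= 1 by near: t; apply: nbhs_right_le.
have qt : q (t *: y + (1 - t) *: x) <= t * q y + (1 - t) * q x.
  exact: cq (Itv01 (ltW t0) t1) y x (mem_set I) (mem_set I).
have -> : t *: (y - x) + x = t *: y + (1 - t) *: x.
  by rewrite scalerBr scalerBl scale1r addrAC addrA.
rewrite /GRing.scale/= mulrC ler_pdivrMr// lerBlDr (le_trans qt)//.
by rewrite le_eqVlt; apply/orP; left; apply/eqP; ring.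
Unshelve. all: by end_near. Qed.

Lemma gradient_first_order f p (e : R) : differentiable f p -> 0 < e ->
  \forall z \near p,
    `|f z - f p - dot (gradient f p) (z - p)| <= e * enorm (z - p).
Proof.
move=> dfp e0.
have /eqaddoP/(_ e e0) := diff_locally dfp.
rewrite [X in X -> _](near_shift p) sub0r => near_le; near=> z.
apply: le_trans (_ : e * `|z - p| <= _); last first.
  by rewrite ler_pM2l// ler_norm_enorm.
have -> : f z - f p - dot (gradient f p) (z - p) =
    (f \o shift p - (cst (f p) + 'd f p)) (z - p).
  rewrite -diff_dot// -addrA -opprD.
  by rewrite -[in f z](subrK p z).
by near: z; exact: near_le.
Unshelve. all: by end_near. Qed.

End calculus.

(** * The descent inequality of a function that is smooth up to a convex shift *)

Section descent.
Variables (R : realType) (n : nat).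
Implicit Types (f h q : 'rV[R]_n -> R) (P : 'rV[R]_n -> \bar R).

Lemma loewner_le_scalar (A B : 'M[R]_n) (l : R) (v a b : 'rV[R]_n) :
  loewner_le (A + B) l%:M -> v *m A = a -> v *m B = b ->
  dot (a + b) v <= l * dot v v.
Proof.
move=> AB <- <-; rewrite -mulmxDr -dotZl -subr_ge0 -dotNl -dotDl -mul_mx_scalar.
by rewrite -mulmxBr; exact: AB.
Qed.

(** The convex [q] is used twice: its Hessian completes that of [h] to a bounded
one, and its gradient inequality removes it again from the bound. *)
Lemma descent_of_convex_shift h q (l : R) x y :
  twice_continuously_differentiable h -> twice_continuously_differentiable q ->
  convex_function setT q ->
  (forall z, loewner_le (hessian h z + hessian q z) l%:M) ->
  h y <= h x + dot (gradient h x) (y - x) + l / 2 * dot (y - x) (y - x).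
Proof.
move=> hC2 qC2 cq hess_le; have [dh dgh _] := hC2; have [dq dgq _] := qC2.
have ub : h y + q y <= h x + q x +
    dot (gradient h x + gradient q x) (y - x) + l / 2 * dot (y - x) (y - x).
  apply: (@quadratic_upper_bound _ _ (h + q) (gradient h + gradient q))
    => [z|z v|z|z v].
  - exact: (differentiableD (dh z) (dq z)).
  - rewrite (diffD (dh z) (dq z)).
    rewrite dotDl; exact: (f_equal2 +%R (diff_dot v (dh z)) (diff_dot v (dq z))).
  - exact: (differentiableD (dgh z) (dgq z)).
  - rewrite (diffD (dgh z) (dgq z)).
    by apply: loewner_le_scalar (hess_le z) _ _; exact: mul_rV_lin1.
have cancel_q (hx hy qx qy a b c : R) :
    hy + qy <= hx + qx + (a + b) + c -> qx + b <= qy -> hy <= hx + a + c.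
  by lra.
move: ub; rewrite dotDl => ub.
exact: cancel_q ub (convex_gradient_le y cq (dq x)).
Qed.

End descent.

(** * Regular subgradients produced by a proximal gradient step *)

Section prox_subgradient.
Variables (R : realType) (n : nat).

Lemma limf_einf_ge0 (T : choiceType) (X : filteredType T) (f : X -> \bar R)
    (F : set_system X) :
  (forall e : R, 0 < e -> \forall z \near F, ((- e)%:E <= f z)%E) ->
  (0 <= limf_einf f F)%E.
Proof.
move=> fF; rewrite /limf_einf oppe_ge0 /limf_esup.
apply/lee_addgt0Pr => e e0; rewrite add0e.
have Fe := fF e e0.
apply: (@le_trans _ _ (ereal_sup [set (\- f)%E z | z in [set z | ((- e)%:E <= f z)%E]])).
  by apply: ereal_inf_lbound; exists [set z | ((- e)%:E <= f z)%E].
apply: ge_ereal_sup => _ [z /= ez <-].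
by rewrite leeNl -EFinN.
Qed.

(** The real inequality behind the next lemma, with [w = z - p], [a = p - u]
and [g], [g'] the gradients at [u] and [p]. The error [e * enorm w] is shared
equally between the expansion of [h] and the quadratic term of the model. *)
Lemma prox_model_minorant (g g' w a : 'rV[R]_n) (beta e hz hp Pz Pp : R) :
  0 < beta ->
  dot g a + (2 * beta)^-1 * dot a a + Pp <=
    dot g (w + a) + (2 * beta)^-1 * dot (w + a) (w + a) + Pz ->
  `|hz - hp - dot g' w| <= e / 2 * enorm w -> enorm w <= beta * e ->
  - e * enorm w <= hz + Pz - (hp + Pp) - dot (g' - g - beta^-1 *: a) w.
Proof.
move=> beta0 + + w_small; rewrite ler_norml => + /andP[first _].
rewrite !dot_lin (dotC a w) -(sqr_enorm w) invfM.
set b := beta^-1; set N := enorm w in first w_small * => min.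
have quad : b * N ^+ 2 <= e * N.
  rewrite expr2 mulrA ler_wpM2r ?sqrtr_ge0// mulrC ler_pdivrMr// mulrC//.
by lra.
Qed.

(** The regular subgradient inequality follows from the minimality of [p] alone:
compared with the linear form, the model contributes only the quadratic term
[(2 * beta)^-1 |z - p|^2], and [h] only the remainder of its first-order
expansion at [p]; both are negligible with respect to [|z - p|]. *)
Lemma prox_step_regular_subgradient (h : 'rV[R]_n -> R) (P : 'rV[R]_n -> \bar R)
    (beta : R) u p :
  0 < beta -> differentiable h p -> (forall z, (-oo < P z)%E) ->
  (P p < +oo)%E -> argmin (prox_gradient_model h P beta u) p ->
  regular_subdifferential (objective h P) p
    (gradient h p - gradient h u - beta^-1 *: (p - u)).
Proof.
move=> beta0 dh PNy Ppy pmin; split.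
  by rewrite inE /effective_domain /objective /= lte_add_pinfty// ltry.
apply: limf_einf_ge0 => e e0.
have Pp : P p \is a fin_num by rewrite fin_numE gt_eqF// lt_eqF.
have e20 : 0 < e / 2 by rewrite divr_gt0.
have near_small : \forall z \near p, enorm (z - p) < beta * e.
  have /cvgrPdist_lt/(_ _ (mulr_gt0 beta0 e0)) := @enorm_cvg _ _ p.
  by apply: filterS => z; rewrite sub0r normrN ger0_norm// sqrtr_ge0.
have near_first := gradient_first_order dh e20.
have Fp : Filter (nbhs p) by have [] := nbhs_pfilter p.
apply: (filterS2 _ _ near_small near_first) => z z_small z_first zp.
have wgt0 : 0 < enorm (z - p) by rewrite enorm_gt0// subr_eq0.
have Pz := PNy z; move: (pmin z); rewrite /prox_gradient_model /objective.
rewrite -(fineK Pp); case: (P z) Pz => [Pz| |] // _; last first.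
  by move=> _; rewrite -!EFinD [((h z)%:E + +oo)%E]addeC !addye// gt0_mulye
    ?leey// lte_fin invr_gt0.
rewrite -!EFinD -EFinM !lee_fin !sqr_enorm ler_pdivlMr// => Pz_ge.
apply: prox_model_minorant beta0 _ z_first (ltW z_small).
by rewrite subrKA.
Qed.

End prox_subgradient.

(** * Sequences *)

Section sequences_facts.
Variable R : realType.

(** The strict bound [k < s k] makes [s] tend to infinity and keeps the terms
of the subsequence away from index 0. *)
Lemma cluster_subsequence (W : normedModType R) (x : nat -> W) a :
  cluster (x t @[t --> \oo]) a ->
  exists2 s : nat -> nat, (forall k, (k < s k)%N) & x (s k) @[k --> \oo] --> a.
Proof.
move=> xa.
have pick k : exists t, (k < t)%N /\ `|a - x t| < k.+1%:R^-1.
  have k0 : 0 < k.+1%:R^-1 :> R by rewrite invr_gt0.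
  have tail : (x t @[t --> \oo]) (x @` [set t | (k < t)%N]).
    by exists k.+1 => // t kt; exists t.
  have [_ [[t kt <-] near_a]] := xa _ _ tail (nbhsx_ballx a _ k0).
  by exists t; split=> //; rewrite -ball_normE in near_a.
have [s sP] := choice pick; exists s => [k|]; first by have [] := sP k.
apply/cvgrPdist_lt => e e0; near=> k.
have [_ /lt_trans] := sP k; apply.
near: k; exact: (near_infty_natSinv_lt (PosNum e0)).
Unshelve. all: by end_near. Qed.

(** The decrements are bounded by the gaps of a convergent monotone sequence. *)
Lemma decrease_cvg0 (phi delta : nat -> R) (m : R) :
  (forall t, 0 <= delta t) -> (forall t, phi t.+1 + delta t <= phi t) ->
  (forall t, m <= phi t) -> delta t @[t --> \oo] --> 0.
Proof.
move=> delta0 dec phi_ge.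
have phi_cvg : cvgn phi.
  apply: nonincreasing_is_cvgn; last by exists m => _ [t _ <-].
  apply/nonincreasing_seqP => t; apply: le_trans (dec t).
  by rewrite lerDl.
have gap : phi t - phi t.+1 @[t --> \oo] --> 0.
  by rewrite -(subrr (limn phi)); apply: cvgB => //; rewrite cvg_shiftS.
apply: squeeze_cvgr (cvg_cst 0) gap; near=> t.
by rewrite delta0/= lerBrDl.
Unshelve. all: by end_near. Qed.

Lemma lsc_cvg (T : topologicalType) (f : T -> \bar R) (I : Type)
    (F : set_system I) {FF : Filter F} (u : I -> T) a (r : R) :
  lower_semicontinuous f -> u t @[t --> F] --> a -> (r%:E < f a)%E ->
  \forall t \near F, (r%:E < f (u t))%E.
Proof.
move=> lscf ua /lscf[V aV Vr].
by apply: (@filterS _ F _ _ _ _ (ua V aV)) => t /Vr.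
Qed.

Lemma cvg_dot0 n (I : Type) (F : set_system I) (FF : Filter F)
    (f : I -> 'rV[R]_n) :
  dot (f t) (f t) @[t --> F] --> (0 : R) -> f t @[t --> F] --> (0 : 'rV[R]_n).
Proof.
move=> /cvgrPdist_lt ff0; apply/cvgrPdist_lt => e e0.
apply: filterS (ff0 _ (exprn_gt0 2 e0)) => t.
rewrite !sub0r !normrN ger0_norm ?dot_ge0// -sqr_enorm.
rewrite ltr_pXn2r ?nnegrE ?sqrtr_ge0 ?ltW//; apply: le_lt_trans.
exact: ler_norm_enorm.
Qed.

End sequences_facts.

(** * Proximal gradient steps and cluster points *)

Section prox_gradient.
Variables (R : realType) (n : nat) (h : 'rV[R]_n -> R) (P : 'rV[R]_n -> \bar R).
Variables (l beta : R).
Hypothesis P_proper : proper_function P.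
Hypothesis beta_gt0 : 0 < beta.

Lemma prox_step_finite u p :
  argmin (prox_gradient_model h P beta u) p -> P p \is a fin_num.
Proof.
have [[z Pz] PNy] := P_proper => pmin; rewrite fin_numE gt_eqF//=.
apply/negP => /eqP Ppy; have := pmin z.
rewrite /prox_gradient_model Ppy addey// leye_eq => /eqP.
by move: Pz (PNy z); rewrite /effective_domain/=; case: (P z).
Qed.

(** Minimality of the model, compared with its value at the centre [u], plus the
descent inequality; when [P u = +oo] the right-hand side is infinite. *)
Lemma prox_step_sufficient_decrease u p :
  h p <= h u + dot (gradient h u) (p - u) + l / 2 * dot (p - u) (p - u) ->
  argmin (prox_gradient_model h P beta u) p ->
  (objective h P p + ((beta^-1 - l) / 2 * dot (p - u) (p - u))%:E
    <= objective h P u)%E.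
Proof.
move=> descent pmin; have [_ PNy] := P_proper.
have := pmin u; have := prox_step_finite pmin.
rewrite /prox_gradient_model /objective subrr sqr_enorm (dotC _ 0) !dot0l.
rewrite sqr_enorm dot0l.
move: (P p) (PNy u) => [Pp| |]// + _; case: (P u) => [Pu| |] // _; last first.
  by rewrite addey ?leey.
rewrite -!EFinD !lee_fin invfM => model_le.
by move: descent model_le; lra.
Qed.

(** Lower semicontinuity alone gives the lower bound on the limit. For the upper
bound, the minimizer [z k] of the model centred at [y k] is compared with the
competitor [a]: the smooth parts of the model vanish at both in the limit. *)
Lemma prox_value_cvg (y z : nat -> 'rV[R]_n) a :
  {for a, continuous (gradient h)} -> lower_semicontinuous P ->
  P a \is a fin_num ->
  (forall k, argmin (prox_gradient_model h P beta (y k)) (z k)) ->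
  y k @[k --> \oo] --> a -> z k @[k --> \oo] --> a ->
  fine (P (z k)) @[k --> \oo] --> fine (P a).
Proof.
move=> gh_cont P_lsc Pa zmin ya za.
have gya : gradient h (y k) @[k --> \oo] --> gradient h a.
  exact: cvg_comp ya gh_cont.
pose gap k := dot (gradient h (y k)) (a - y k)
  + (2 * beta)^-1 * dot (a - y k) (a - y k)
  - (dot (gradient h (y k)) (z k - y k)
     + (2 * beta)^-1 * dot (z k - y k) (z k - y k)).
have gap0 : gap k @[k --> \oo] --> 0.
  have ay : a - y k @[k --> \oo] --> (0 : 'rV[R]_n).
    by rewrite -(subrr a); apply: cvgB => //; exact: cvg_cst.
  have zy : z k - y k @[k --> \oo] --> (0 : 'rV[R]_n).
    by rewrite -(subrr a); exact: cvgB.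
  have model0 (d : nat -> 'rV[R]_n) : d k @[k --> \oo] --> (0 : 'rV[R]_n) ->
      dot (gradient h (y k)) (d k) + (2 * beta)^-1 * dot (d k) (d k)
        @[k --> \oo] --> (0 : R).
    move=> d0; have -> : (0 : R) =
        dot (gradient h a) 0 + (2 * beta)^-1 * dot 0 (0 : 'rV[R]_n).
      by rewrite (dotC _ 0) !dot0l mulr0 addr0.
    apply: cvgD; first exact: (cvg_dot _ gya d0).
    by apply: cvgM; [exact: cvg_cst|exact: (cvg_dot _ d0 d0)].
  by rewrite -(subr0 0); apply: cvgB; exact: model0.
have Pz_le k : fine (P (z k)) <= fine (P a) + gap k.
  have := zmin k a; have := prox_step_finite (zmin k).
  rewrite /prox_gradient_model /gap !sqr_enorm.
  move: Pa; case: (P a) => [Pa| |]// _.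
  case: (P (z k)) => [r| |]// _; rewrite -!EFinD lee_fin/=.
  move: (dot (gradient h (y k)) _ + _) (dot (gradient h (y k)) _ + _) => A B.
  by lra.
apply/cvgrPdist_lt => e e0.
have lower : \forall k \near \oo, ((fine (P a) - e)%:E < P (z k))%E.
  apply: lsc_cvg P_lsc za _.
  by rewrite -(fineK Pa) lte_fin ltrBlDr ltrDl.
near=> k.
have lowk : ((fine (P a) - e)%:E < P (z k))%E by near: k.
have gapk : `|gap k| < e.
  by near: k; move/cvgr0Pnorm_lt : gap0; apply.
rewrite -(fineK (prox_step_finite (zmin k))) lte_fin in lowk.
have close (A B D : R) : B - e < A -> A <= B + D -> D < e -> `|B - A| < e.
  by move=> *; rewrite ltr_norml; apply/andP; split; lra.
exact: close lowk (Pz_le k) (le_lt_trans (ler_norm _) gapk).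
Unshelve. all: by end_near. Qed.

(** All estimates use the values of [F] from index 1 on, hence the shift in [phi]
and [delta]: the initial point may lie outside the domain of [P], while every
later iterate lies inside. *)
Lemma prox_cluster_stationary (x : nat -> 'rV[R]_n) a :
  (forall z, differentiable h z) -> continuous (gradient h) ->
  lower_semicontinuous P -> beta < l^-1 -> 0 < l ->
  (forall u p,
    h p <= h u + dot (gradient h u) (p - u) + l / 2 * dot (p - u) (p - u)) ->
  prox_gradient_sequence h P beta x ->
  cluster (x t @[t --> \oo]) a -> stationary_point h P a.
Proof.
move=> dh cgh P_lsc beta_lt l_gt0 descent xprox /cluster_subsequence[s s_gt xs_a].
have [_ PNy] := P_proper.
have ch : {for a, continuous h} by exact: differentiable_continuous.
have hxs : h (x (s k)) @[k --> \oo] --> h a by exact: cvg_comp xs_a ch.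
have Pfin t : P (x t.+1) \is a fin_num by exact: prox_step_finite (xprox t).
pose phi t := h (x t.+1) + fine (P (x t.+1)).
pose delta t := (beta^-1 - l) / 2 * dot (x t.+2 - x t.+1) (x t.+2 - x t.+1).
have c_gt0 : 0 < (beta^-1 - l) / 2.
  by rewrite divr_gt0// subr_gt0 -(invrK l) ltf_pV2// posrE invr_gt0.
have phi_dec t : phi t.+1 + delta t <= phi t.
  have := prox_step_sufficient_decrease (descent (x t.+1) (x t.+2)) (xprox t.+1).
  rewrite /objective -(fineK (Pfin t)) -(fineK (Pfin t.+1)) -!EFinD lee_fin.
  exact.
have delta_ge0 t : 0 <= delta t by rewrite mulr_ge0 ?dot_ge0// ltW.
have phi_homo : {homo phi : i j / (i <= j)%N >-> j <= i}.
  apply/nonincreasing_seqP => t; apply: le_trans (phi_dec t).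
  by rewrite lerDl.
have sE k : (s k).-1.+1 = s k by rewrite prednK// (leq_ltn_trans _ (s_gt k)).
(* Near [a], [P] exceeds [r] and [h] exceeds [h a - 1]; the subsequence gets there
   arbitrarily late. *)
have above (r : R) K : (r%:E < P a)%E ->
    exists2 t, (K <= t)%N & h a - 1 + r <= phi t.
  move=> /(lsc_cvg P_lsc xs_a) Pr.
  have hr : \forall k \near \oo, h a - 1 < h (x (s k)).
    by apply: cvgr_gt hxs _ _; rewrite ltrBlDr ltrDl.
  near \oo => k.
  have Prk : (r%:E < P (x (s k)))%E by near: k.
  have hrk : h a - 1 < h (x (s k)) by near: k.
  have Kk : (K <= k)%N by near: k; exact: nbhs_infty_ge.
  exists (s k).-1; first by rewrite (leq_trans Kk)// -ltnS sE.
  have r_lt : r < fine (P (x (s k))) by rewrite -lte_fin fineK// -sE.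
  by rewrite /phi sE lerD// ltW.
have Pa : P a \is a fin_num.
  rewrite fin_numE gt_eqF//=; apply/negP => /eqP Pay.
  (* This [r] would force [phi t] to be at least [phi 0 + 1]. *)
  have [t _] := above (phi 0 - h a + 2) 0 ltac:(by rewrite Pay ltry).
  have := phi_homo 0 t (leq0n t); lra.
have phi_ge t : h a - 1 + (fine (P a) - 1) <= phi t.
  have [t' tt'] := above (fine (P a) - 1) t
    ltac:(by rewrite -{2}(fineK Pa) lte_fin ltrBlDr ltrDl).
  by move/le_trans; apply; exact: phi_homo.
have step0 : x t.+1 - x t @[t --> \oo] --> (0 : 'rV[R]_n).
  rewrite -cvg_shiftS; apply: cvg_dot0.
  have -> : (fun t => dot (x t.+2 - x t.+1) (x t.+2 - x t.+1)) =
      (fun t => ((beta^-1 - l) / 2)^-1 * delta t).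
    by apply/funext => t; rewrite /delta mulKf// gt_eqF.
  rewrite -(mulr0 ((beta^-1 - l) / 2)^-1).
  by apply: cvgM; [exact: cvg_cst|exact: decrease_cvg0 delta_ge0 phi_dec phi_ge].
have s_oo : s k @[k --> \oo] --> \oo.
  move=> A [N _ NA]; exists N => // k /= Nk; apply: NA => /=.
  exact: leq_trans Nk (ltnW (s_gt k)).
have steps0 : x (s k).+1 - x (s k) @[k --> \oo] --> (0 : 'rV[R]_n).
  exact: cvg_comp s_oo step0.
have xs1_a : x (s k).+1 @[k --> \oo] --> a.
  have -> : (fun k => x (s k).+1) = (fun k => x (s k) + (x (s k).+1 - x (s k))).
    by apply/funext => k; rewrite addrC subrK.
  by rewrite -[a in X in _ --> X]addr0; exact: cvgD.
have Pxs1 := prox_value_cvg (cgh a) P_lsc Pa (fun k => xprox (s k)) xs_a xs1_a.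
split; first by rewrite inE /effective_domain /objective/= -(fineK Pa) -EFinD ltry.
exists (fun k => x (s k).+1), (fun k => gradient h (x (s k).+1)
  - gradient h (x (s k)) - beta^-1 *: (x (s k).+1 - x (s k))); split => //.
- rewrite /objective -(fineK Pa) -EFinD; apply: cvg_EFin.
    by apply: nearW => k; rewrite fin_numD/= Pfin.
  have -> : fine \o (fun k => (h (x (s k).+1))%:E + P (x (s k).+1))%E =
      (fun k => h (x (s k).+1) + fine (P (x (s k).+1))).
    by apply/funext => k /=; rewrite fineD.
  by apply: cvgD => //; exact: cvg_comp xs1_a ch.
- rewrite -(subrr 0) -{2}(scaler0 _ (beta^-1)) -{1}(subrr (gradient h a)).
  apply: cvgB.
    by apply: cvgB; [exact: cvg_comp xs1_a (cgh a)|exact: cvg_comp xs_a (cgh a)].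
  by apply: cvgZ => //; exact: cvg_cst.
- move=> k; apply: prox_step_regular_subgradient => //.
  by rewrite -(fineK (Pfin _)) ltry.
Unshelve. all: by end_near. Qed.

End prox_gradient.

Theorem theorem4 (R : realType) (n : nat)
    (h : 'rV[R]_n -> R) (P : 'rV[R]_n -> \bar R)
    (h_C2 : twice_continuously_differentiable h)
    (h_bounded : bounded_fun (hessian h))
    (P_proper : proper_function P)
    (P_closed : lower_semicontinuous P)
    (P_prox : forall (u : 'rV[R]_n) (tau : R), 0 < tau ->
       argmin (prox_objective P tau u) !=set0)
    (q : 'rV[R]_n -> R) (l : R)
    (q_C2 : twice_continuously_differentiable q)
    (q_convex : convex_function setT q)
    (l_gt0 : 0 < l)
    (hq_bounds : forall x : 'rV[R]_n,
       loewner_le (- l%:M) (hessian h x + hessian q x) /\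
       loewner_le (hessian h x + hessian q x) l%:M)
    (beta : R) (beta_gt0 : 0 < beta) (beta_lt : beta < l^-1)
    (x : nat -> 'rV[R]_n)
    (x_prox : prox_gradient_sequence h P beta x) :
  (forall t : nat, (objective h P (x t.+1) <= objective h P (x t))%E) /\
  (forall xstar : 'rV[R]_n, cluster (x t @[t --> \oo]) xstar ->
     stationary_point h P xstar).
Proof.
have descent u p :
    h p <= h u + dot (gradient h u) (p - u) + l / 2 * dot (p - u) (p - u).
  exact: descent_of_convex_shift h_C2 q_C2 q_convex (fun z => proj2 (hq_bounds z)).
have [dh dgh _] := h_C2; split=> [t|a].
  apply: le_trans (prox_step_sufficient_decrease P_proper (descent _ _) (x_prox t)).
  rewrite leeDl// lee_fin mulr_ge0 ?dot_ge0// divr_ge0// subr_ge0 ltW//.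
  by rewrite -(invrK l) ltf_pV2// posrE invr_gt0.
apply: prox_cluster_stationary beta_lt l_gt0 descent x_prox => //.
by move=> z; exact: differentiable_continuous.
Qed.
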